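(* Let $\mathbb{K}=\mathbb{C}(a,\mathbf{p},\mathbf{q})$ and let $\mathcal{F}:\mathbb{K}[x^{\pm1},y^{\pm1}]\to\mathbb{K}$ be the $\mathbb{K}$-linear functional with moments $\mathcal{F}[x^iy^j]=f_{i,j}$, $(i,j)\in\mathbb{Z}^2$, where $$f_{i,j}=\prod_{k=0}^{i-1}(1-a\mathbf{p}^{\overline{k}}\mathbf{q}^{\overline{j}})\ \text{ if } i>0,\qquad f_{0,j}=1,\qquad f_{i,j}=\prod_{k=i}^{-1}(1-a\mathbf{p}^{\overline{k}}\mathbf{q}^{\overline{j}})^{-1}\ \text{ if } i<0.$$ Then for every $(r,c)\in\mathbb{Z}^2$ and $n\in\mathbb{Z}_{\ge0}$ the generalized little $q$-Laguerre polynomial $\mathcal{L}^{(r,c)}_{n}(x;a;\mathbf{p},\mathbf{q})$ satisfies the orthogonality $$\mathcal{F}\left[x^{r} y^{c+j}\, \mathcal{L}^{(r,c)}_{n}(x;a;\mathbf{p},\mathbf{q})\right] = h^{(r,c)}_{n}\, \delta_{j,n}, \qquad 0 \le j \le n,$$ with $$h^{(r,c)}_{n} = f_{r,c+n} \, a^{n} \prod_{k=0}^{n-1} \mathbf{p}^{\overline{r+k}} \left(\mathbf{q}^{\overline{c+k}} - \mathbf{q}^{\overline{c+n}}\right)\neq 0.$$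
   Context: $a$, $p_i$ ($i\in\mathbb{Z}$), $q_j$ ($j\in\mathbb{Z}$) are indeterminates, $\mathbf{p}=(p_i)_{i\in\mathbb{Z}}$, $\mathbf{q}=(q_j)_{j\in\mathbb{Z}}$. For a bilateral sequence $\mathbf{x}=(x_k)_{k\in\mathbb{Z}}$ and $m\in\mathbb{Z}$, $\mathbf{x}^{\overline{m}}=\prod_{k=1}^{m}x_k$ if $m>0$, $\mathbf{x}^{\overline{0}}=1$, and $\mathbf{x}^{\overline{m}}=\prod_{k=m+1}^{0}x_k^{-1}$ if $m<0$. $\mathbf{x}_s$ denotes the $s$-shifted sequence whose $k$-th entry is $x_{s+k}$. The generalized little $q$-Laguerre polynomial of degree $n\in\mathbb{Z}_{\ge0}$ is $$\mathcal{L}_{n}(x;a;\mathbf{p},\mathbf{q}) = \sum_{i=0}^{n} x^{i} \left( \prod_{k=i}^{n-1} \mathbf{p}^{\overline{k}} \right) \sum_{i \ge \nu_{i} \ge \cdots \ge \nu_{n-1} \ge 0} \prod_{k=i}^{n-1} \left( a \mathbf{q}^{\overline{k-\nu_k}} - \frac{1}{\mathbf{p}^{\overline{\nu_k}}} \right),$$ where the second sum is over all $n-i$ non-increasing nonnegative integers $\nu_i,\dots,\nu_{n-1}$ at most $i$ (for $i=n$ it equals $1$). For $(r,c)\in\mathbb{Z}^2$, $$\mathcal{L}^{(r,c)}_{n}(x;a;\mathbf{p},\mathbf{q}) = \mathcal{L}_{n}(x;a \mathbf{p}^{\overline{r}} \mathbf{q}^{\overline{c}}; \mathbf{p}_{r},\mathbf{q}_{c}).$$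 $\delta_{j,n}$ is the Kronecker delta. *)

(* Defs.v *)
From HB Require Import structures.
From mathcomp Require Import all_boot all_order all_algebra.
From mathcomp Require Import finmap complex.
From mathcomp Require Import reals.
From mathcomp Require Import monalg.

Set Implicit Arguments.
Unset Strict Implicit.
Unset Printing Implicit Defensive.

Import Order.TTheory GRing.Theory Num.Theory.
Local Open Scope ring_scope.

(** * Polynomials in countably many indeterminates form an integral domain

    [{malg R[{cmonom I}]}] is the polynomial ring over [R] in the family of
    indeterminates [I]. The absence of zero divisors is proved by comparing
    leading monomials for the lexicographic order induced by an enumeration
    of [I]. *)

Section MonomialOrder.
Variable I : countType.
Implicit Types m : {cmonom I}.

Let rk (i : I) : nat := choice.pickle i.

Let rk_inj : injective rk.
Proof. exact: (pcan_inj choice.pickleK). Qed.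

Definition cmlt m1 m2 :=
  exists2 i : I, (m1 i < m2 i)%N
    & forall j : I, (rk j < rk i)%N -> m1 j = m2 j.

Lemma cmlt_irr m : ~ cmlt m m.
Proof. by case=> i; rewrite ltnn. Qed.

Lemma cmlt_trans m2 m1 m3 : cmlt m1 m2 -> cmlt m2 m3 -> cmlt m1 m3.
Proof.
move=> [i lti eqi] [j ltj eqj]; case: (ltngtP (rk i) (rk j)) => [ij|ji|].
- exists i; first by rewrite -(eqj _ ij).
  by move=> k ki; rewrite (eqi _ ki) (eqj _ (ltn_trans ki ij)).
- exists j; first by rewrite (eqi _ ji).
  by move=> k kj; rewrite (eqi _ (ltn_trans kj ji)) (eqj _ kj).
- move/rk_inj => eij; subst j.
  exists i; first exact: ltn_trans lti ltj.
  by move=> k ki; rewrite (eqi _ ki) (eqj _ ki).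
Qed.

Lemma cmlt_total m1 m2 : m1 != m2 -> cmlt m1 m2 \/ cmlt m2 m1.
Proof.
move=> ne12.
pose P n := has (fun i => (rk i == n) && (m1 i != m2 i))
              (enum_fset (finsupp m1 `|` finsupp m2)%fset).
have PI i : m1 i != m2 i -> P (rk i).
  move=> d; apply/hasP; exists i; last by rewrite eqxx.
  rewrite in_fsetU; apply: contraNT d; rewrite negb_or -!cmE_eq0.
  by move=> /andP[/eqP-> /eqP->].
have exP : exists n, P n.
  case: (boolP (has (fun i => m1 i != m2 i)
              (enum_fset (finsupp m1 `|` finsupp m2)%fset))).
    by case/hasP=> i _ d; exists (rk i); apply: PI.
  move=> /hasPn nd; case/negP: ne12; apply/cmP => i; apply/eqP.
  case: (boolP (i \in (finsupp m1 `|` finsupp m2)%fset)) => [/nd|].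
    by rewrite negbK.
  by rewrite in_fsetU negb_or -!cmE_eq0 => /andP[/eqP-> /eqP->].
have [n /hasP[i _ /andP[/eqP ein neqi]] minn] := ex_minnP exP.
have eqlt j : (rk j < rk i)%N -> m1 j = m2 j.
  move=> ji; apply/eqP; apply: contraTT ji => d; rewrite -leqNgt ein.
  exact/minn/PI.
case: (ltngtP (m1 i) (m2 i)) => [lt|lt|eq]; last by rewrite eq eqxx in neqi.
- by left; exists i.
- by right; exists i => // j ji; rewrite eqlt.
Qed.

Lemma cmlt_mulr m m1 m2 : cmlt m1 m2 -> cmlt (mmul m1 m) (mmul m2 m).
Proof.
move=> [i lti eqi]; exists i; first by rewrite !cmM ltn_add2r.
by move=> j ji; rewrite !cmM eqi.
Qed.

Lemma cmlt1 m : m != mone -> cmlt mone m.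
Proof. by move=> /cmlt_total[[k]|//]; rewrite cm1. Qed.

End MonomialOrder.

Section OrderedMonomials.
Variables (M : conomType) (lt : M -> M -> Prop).
Hypothesis lt_irr : forall m, ~ lt m m.
Hypothesis lt_trans : forall m2 m1 m3, lt m1 m2 -> lt m2 m3 -> lt m1 m3.
Hypothesis lt_total : forall m1 m2, m1 != m2 -> lt m1 m2 \/ lt m2 m1.
Hypothesis lt1 : forall m, m != mone -> lt mone m.
Hypothesis lt_mulr : forall m m1 m2, lt m1 m2 -> lt (mmul m1 m) (mmul m2 m).

Lemma lt_mul m1 m2 k1 k2 :
  lt k1 m1 -> k2 = m2 \/ lt k2 m2 -> lt (mmul k1 k2) (mmul m1 m2).
Proof.
move=> ltm1 [->|ltm2]; first exact: lt_mulr.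
apply: lt_trans (lt_mulr k2 ltm1) _.
by rewrite ![mmul m1 _]mulmC; apply: lt_mulr.
Qed.

Variable R : idomainType.
Implicit Types g : {malg R[M]}.

Definition is_lead m g :=
  m \in msupp g /\ forall k, k \in msupp g -> k = m \/ lt k m.

Lemma lead_exists g : g != 0 -> exists m, is_lead m g.
Proof.
rewrite -msupp_eq0 => nz.
have: exists m, m \in enum_fset (msupp g).
  by have /fset0Pn[m mg] := nz; exists m.
rewrite /is_lead; move: (msupp g) {nz} => S.
suff H (s : seq M) : (exists m, m \in s) ->
   exists m, m \in s /\ forall k, k \in s -> k = m \/ lt k m by exact: H.
elim: s => [[]//|x s IHs] _.
case: s IHs => [_|y s IHs].
  exists x; rewrite mem_head; split=> // k.
  by rewrite inE => /eqP->; left.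
have [|m [ms mmax]] := IHs; first by exists y; rewrite mem_head.
have [exm|/lt_total[xm|mx]] := eqVneq x m.
- exists m; rewrite inE ms orbT; split=> // k; rewrite inE.
  by case/orP=> [/eqP->|/mmax//]; left.
- exists m; rewrite inE ms orbT; split=> // k; rewrite inE.
  by case/orP=> [/eqP->|/mmax//]; right.
- exists x; rewrite mem_head; split=> // k; rewrite inE.
  case/orP=> [/eqP->|/mmax le_km]; [by left | right].
  by case: le_km => [->//|lt_km]; exact: lt_trans lt_km mx.
Qed.

Lemma mcoeff_lead m1 m2 g1 g2 : is_lead m1 g1 -> is_lead m2 g2 ->
  (g1 * g2)@_(mmul m1 m2) = g1@_m1 * g2@_m2.
Proof.
move=> [m1g max1] [m2g max2]; rewrite mcoeffMl.
rewrite (big_fsetD1 _ m1g) /= [X in _ + X]big1_fset ?addr0; last first.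
  move=> k1; rewrite in_fsetD1 => /andP[ne1 /max1[e1|ltm1]] _.
    by rewrite e1 eqxx in ne1.
  rewrite big1_fset // => k2 /max2 le2 _.
  by case: eqP => // e; move: (lt_mul ltm1 le2); rewrite e => /lt_irr.
rewrite (big_fsetD1 _ m2g) /= [X in _ + X]big1_fset ?addr0 ?eqxx //.
move=> k2; rewrite in_fsetD1 => /andP[ne2 /max2[e2|lt2]] _.
  by rewrite e2 eqxx in ne2.
case: eqP => //; rewrite ![mmul m1 _]mulmC => e.
by move: (lt_mulr m1 lt2); rewrite e => /lt_irr.
Qed.

Lemma mpoly_mulf_eq0 g1 g2 : g1 * g2 = 0 -> (g1 == 0) || (g2 == 0).
Proof.
move=> g12; case: (boolP (g1 == 0)) => //= /lead_exists[m1 l1].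
apply: contraT => /lead_exists[m2 l2].
have /eqP := mcoeff_lead l1 l2.
rewrite g12 mcoeff0 eq_sym mulf_eq0 !mcoeff_eq0.
by case: l1 l2 => -> _ [-> _].
Qed.

Definition mpoly_unit : pred {malg R[M]} :=
  fun g => (g == (g@_mone)%:MP) && (g@_mone \is a GRing.unit).

Definition mpoly_inv g := if mpoly_unit g then ((g@_mone)^-1)%:MP else g.

Lemma mpoly_mulVf : {in mpoly_unit, left_inverse 1 mpoly_inv *%R}.
Proof.
move=> g ug; have ug' : mpoly_unit g := ug; rewrite /mpoly_inv ug'.
case/andP: ug' => /eqP e u.
suff: ((g@_mone)^-1)%:MP * (g@_mone)%:MP = 1 :> {malg R[M]} by rewrite -e.
by rewrite -rmorphM mulVr // rmorph1.
Qed.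

Lemma mpoly_unitPl g1 g2 : g2 * g1 = 1 -> mpoly_unit g1.
Proof.
move=> e.
have nz1 : g1 != 0 by apply: contra_eq_neq e => ->; rewrite mulr0 eq_sym oner_eq0.
have nz2 : g2 != 0 by apply: contra_eq_neq e => ->; rewrite mul0r eq_sym oner_eq0.
have [m1 l1] := lead_exists nz1; have [m2 l2] := lead_exists nz2.
have /eqP := mcoeff_lead l2 l1; rewrite e mcoeff1.
case: (mmul m2 m1 =P mone) => [m12 _|_]; last first.
  by rewrite eq_sym mulf_eq0 !mcoeff_eq0; case: l1 l2 => -> _ [-> _].
have [_ m1E] := unitm _ _ m12.
have g1C : g1 = (g1@_mone)%:MP.
  apply/malgP => k; rewrite mcoeffC; case: eqP => [->//|/eqP nek].
  rewrite mulr0n; apply: mcoeff_outdom; apply/negP => /(proj2 l1).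
  rewrite m1E => -[ek|ltk]; first by rewrite ek eqxx in nek.
  exact: lt_irr (lt_trans ltk (lt1 nek)).
rewrite /mpoly_unit -g1C eqxx /=; apply/unitrPr; exists (g2@_mone).
have := congr1 (mcoeff mone) e; rewrite g1C mulrC mcoeffCM mcoeff1 eqxx.
by rewrite mcoeffC eqxx.
Qed.

Lemma mpoly_inv_out : {in [predC mpoly_unit], mpoly_inv =1 id}.
Proof. move=> g ng; have {}ng : ~~ mpoly_unit g by [].
by rewrite /mpoly_inv (negbTE ng). Qed.

End OrderedMonomials.

Section PolynomialDomain.
Variables (I : countType) (R : idomainType).

HB.instance Definition _ := GRing.ComNzRing_hasMulInverse.Build
  (malg (cmonom I) R) (@mpoly_mulVf (cmonom I) R)
  (mpoly_unitPl (@cmlt_irr I) (@cmlt_trans I) (@cmlt_total I) (@cmlt1 I)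
     (@cmlt_mulr I) (R := R))
  (@mpoly_inv_out (cmonom I) R).
HB.instance Definition _ := GRing.ComUnitRing_isIntegral.Build
  (malg (cmonom I) R)
  (mpoly_mulf_eq0 (@cmlt_irr I) (@cmlt_trans I) (@cmlt_total I)
     (@cmlt_mulr I) (R := R)).
End PolynomialDomain.

(** * The field of rational functions in [a], [p_i], [q_j] *)

Inductive indet : Type := IndA | IndP of int | IndQ of int.

Definition indet_code (v : indet) : option (int + int) :=
  match v with
  | IndA => None
  | IndP i => Some (inl i)
  | IndQ j => Some (inr j)
  end.

Definition indet_decode (v : option (int + int)) : indet :=
  match v with
  | None => IndA
  | Some (inl i) => IndP i
  | Some (inr j) => IndQ j
  end.

Lemma indet_codeK : cancel indet_code indet_decode.
Proof. by case. Qed.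

HB.instance Definition _ := Countable.copy indet (can_type indet_codeK).

Definition ratfun (C : idomainType) : fieldType :=
  {fraction {malg C[{cmonom indet}]}}.

Section Generators.
Variable C : idomainType.

Definition gen (v : indet) : ratfun C :=
  FracField.tofrac (<< ucm v >> : {malg C[{cmonom indet}]}).

Definition gen_a : ratfun C := gen IndA.
Definition gen_p (i : int) : ratfun C := gen (IndP i).
Definition gen_q (j : int) : ratfun C := gen (IndQ j).
End Generators.

(** * Laurent polynomials in [x] and [y]

    [laurent K] is the free [K]-module on [int * int], where [(i, j)] stands
    for [x ^ i * y ^ j], with the convolution product. ([monalg] does not
    provide the product, because its monomials have no inverses.) *)

Definition laurent (K : fieldType) : Type := {malg K[(int * int)%type]}.

HB.instance Definition _ (K : fieldType) := GRing.Lmodule.on (laurent K).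

Section Laurent.
Variable K : fieldType.
Implicit Types (g : laurent K) (k : int * int) (d : {fset (int * int)}).

Local Notation U c k := (mkmalgU k c : laurent K).

Definition lone : laurent K := U 1 (0, 0).

Definition lmul g1 g2 : laurent K :=
  \sum_(k1 <- msupp g1) \sum_(k2 <- msupp g2) U (g1@_k1 * g2@_k2) (k1 + k2).

Lemma lmulw d1 d2 g1 g2 :
  (msupp g1 `<=` d1)%fset -> (msupp g2 `<=` d2)%fset ->
  lmul g1 g2 = \sum_(k1 <- d1) \sum_(k2 <- d2) U (g1@_k1 * g2@_k2) (k1 + k2).
Proof.
move=> le_d1 le_d2; rewrite /lmul (big_fset_incl _ le_d1) /=.
  apply/eq_bigr=> k1 _; apply/big_fset_incl => // k _ /mcoeff_outdom ->.
  by rewrite mulr0 monalgU0.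
move=> k _ /mcoeff_outdom g1k.
by rewrite big1 => // k' _; rewrite g1k mul0r monalgU0.
Qed.

Lemma lmulC : commutative lmul.
Proof.
move=> g1 g2; rewrite /lmul exchange_big; apply/eq_bigr => k2 _.
by apply/eq_bigr => k1 _; rewrite mulrC addrC.
Qed.

Lemma lmulDl : left_distributive lmul +%R.
Proof.
move=> g1 g2 g; have s := fsubset_refl (msupp g).
rewrite [in RHS](lmulw (fsubsetUl _ (msupp g2)) s).
rewrite [in RHS](lmulw (fsubsetUr (msupp g1) _) s).
rewrite [LHS](lmulw (msuppD_le g1 g2) s).
rewrite -big_split /=; apply/eq_bigr=> k1 _.
rewrite -big_split /=; apply/eq_bigr=> k2 _.
by rewrite mcoeffD mulrDl monalgUD.
Qed.

Lemma lmul0g : left_zero 0 lmul.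
Proof. by move=> g; rewrite /lmul msupp0 big_seq_fset0. Qed.

Lemma lmulUU c1 c2 k1 k2 : lmul (U c1 k1) (U c2 k2) = U (c1 * c2) (k1 + k2).
Proof. by rewrite (lmulw msuppU_le msuppU_le) !big_seq_fset1 !mcoeffUU. Qed.

Lemma lmul_suml (J : Type) (r : seq J) (E : J -> laurent K) g :
  lmul (\sum_(j <- r) E j) g = \sum_(j <- r) lmul (E j) g.
Proof. exact: (big_morph (lmul^~ g) (fun _ _ => lmulDl _ _ _) (lmul0g g)). Qed.

Lemma lmul_sumr (J : Type) (r : seq J) (E : J -> laurent K) g :
  lmul g (\sum_(j <- r) E j) = \sum_(j <- r) lmul g (E j).
Proof. by rewrite lmulC lmul_suml; apply/eq_bigr => j _; rewrite lmulC. Qed.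

Lemma lsumE g : g = \sum_(k <- msupp g) U (g@_k) k :> laurent K.
Proof. exact: monalgE. Qed.

Lemma lmulA : associative lmul.
Proof.
have A1 c1 k1 c2 k2 g : lmul (U c1 k1) (lmul (U c2 k2) g)
    = lmul (lmul (U c1 k1) (U c2 k2)) g.
  rewrite (lsumE g) [in LHS]lmul_sumr [LHS]lmul_sumr [RHS]lmul_sumr.
  by apply: eq_bigr => k3 _; rewrite !lmulUU mulrA addrA.
have A2 c1 k1 g2 g3 : lmul (U c1 k1) (lmul g2 g3) = lmul (lmul (U c1 k1) g2) g3.
  rewrite (lsumE g2) [in LHS]lmul_suml [LHS]lmul_sumr.
  rewrite [in RHS]lmul_sumr [RHS]lmul_suml.
  by apply: eq_bigr => k2 _; exact: A1.
move=> g1 g2 g3; rewrite (lsumE g1) [LHS]lmul_suml.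
rewrite [in RHS]lmul_suml [RHS]lmul_suml.
by apply: eq_bigr => k1 _; exact: A2.
Qed.

Lemma lmul1g : left_id lone lmul.
Proof.
move=> g; rewrite [in LHS](lsumE g) lmul_sumr [RHS]lsumE.
by apply: eq_bigr => -[k l] _; rewrite lmulUU mul1r add0r.
Qed.

Lemma lone_neq0 : lone != 0.
Proof. by rewrite monalgU_eq0 oner_eq0. Qed.

HB.instance Definition _ := GRing.Zmodule_isComNzRing.Build (laurent K)
  lmulA lmulC lmul1g lmulDl lone_neq0.

Lemma lscaleU (b c : K) k : b *: U c k = U (b * c) k.
Proof.
apply/malgP => l; have -> := mcoeffZ b (U c k) l.
by have -> := mcoeffU k c l; have -> := mcoeffU k (b * c) l; rewrite mulrnAr.
Qed.

Lemma lscaleE (c : K) g : c *: g = lmul (U c 0) g.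
Proof.
rewrite [in RHS](lsumE g) lmul_sumr [in LHS](lsumE g) scaler_sumr.
by apply: eq_bigr => k _; rewrite lscaleU lmulUU add0r.
Qed.

Lemma laurent_scaleAl (c : K) g1 g2 : c *: (g1 * g2) = (c *: g1) * g2.
Proof. by rewrite !lscaleE [LHS]lmulA. Qed.

HB.instance Definition _ := GRing.Lmodule_isLalgebra.Build K (laurent K)
  laurent_scaleAl.
HB.instance Definition _ := GRing.Lalgebra_isComAlgebra.Build K (laurent K).

Definition lmon (i j : int) : laurent K := U 1 (i, j).

Lemma lmon0 : lmon 0 0 = 1.
Proof. by []. Qed.

Lemma lmonM i1 j1 i2 j2 : lmon i1 j1 * lmon i2 j2 = lmon (i1 + i2) (j1 + j2).
Proof. by rewrite [LHS]lmulUU mulr1. Qed.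

Lemma laurentE g : g = \sum_(k <- msupp g) g@_k *: lmon k.1 k.2.
Proof.
rewrite [LHS]lsumE; apply: eq_bigr => -[k l] _.
by rewrite lscaleU mulr1.
Qed.

Lemma functional_exists (f : int -> int -> K) :
  exists F : {scalar laurent K}, forall i j, F (lmon i j) = f i j.
Proof.
pose F g := \sum_(k <- msupp g) g@_k * f k.1 k.2.
have Fw d g : (msupp g `<=` d)%fset -> F g = \sum_(k <- d) g@_k * f k.1 k.2.
  move=> le_d; apply: big_fset_incl => // k _ /mcoeff_outdom ->.
  by rewrite mul0r.
have lF : scalar F.
  move=> c g1 g2; pose d := (msupp g1 `|` msupp g2)%fset.
  have s1 : (msupp g1 `<=` d)%fset by exact: fsubsetUl.
  have s2 : (msupp g2 `<=` d)%fset by exact: fsubsetUr.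
  have s3 : (msupp (c *: g1 + g2) `<=` d)%fset.
    exact: fsubset_trans (msuppD_le _ _) (fsetSU _ (msuppZ_le _ _)).
  rewrite (Fw _ _ s1) (Fw _ _ s2) (Fw _ _ s3) mulr_sumr -big_split /=.
  by apply: eq_bigr => k _; rewrite mcoeffD mcoeffZ mulrDl mulrA.
pose m := GRing.isLinear.Build K (laurent K) K *%R F lF.
pose FL : {scalar laurent K} := HB.pack F m.
exists FL => i j; rewrite /= (Fw _ _ msuppU_le) big_seq_fset1 /=.
by rewrite mcoeffUU mul1r.
Qed.
End Laurent.

Lemma functional_unique (K : fieldType) (F G : {scalar laurent K}) :
  (forall i j, F (lmon K i j) = G (lmon K i j)) -> F =1 G.
Proof.
move=> FG g; rewrite (laurentE g) !linear_sum; apply: eq_bigr => k _.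
by rewrite !linearZ FG.
Qed.

(** * Generalized little q-Laguerre polynomials *)

Section LittleQLaguerre.
Variable K : fieldType.
Implicit Types (a : K) (p q x : int -> K) (m r c : int) (n : nat).

(* [Negz m] is [- m.+1]; the index [k] of the second product is the opposite
   of the one ranging over [- m.+1 + 1 .. 0] *)
Definition bpow x m : K :=
  match m with
  | Posz m => \prod_(1 <= k < m.+1) x k%:Z
  | Negz m => \prod_(0 <= k < m.+1) (x (- k%:Z))^-1
  end.

Definition bshift (s : int) x : int -> K := fun k => x (s + k).

(* the sequence nu_i, ..., nu_(n-1) is indexed from 0: [nu s] is nu_(i+s) *)
Definition lqLaguerre n a p q : {poly K} :=
  \sum_(0 <= i < n.+1)
    ((\prod_(i <= k < n) bpow p k%:Z) *
     \sum_(nu : {ffun 'I_(n - i) -> 'I_i.+1}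
             | [forall s : 'I_(n - i), forall t : 'I_(n - i),
                  (s <= t)%N ==> (nu t <= nu s)%N])
        \prod_(s < n - i)
          (a * bpow q ((i + s)%N%:Z - (nu s)%:Z) - (bpow p (nu s)%:Z)^-1))
    *: 'X^i.

Definition lqLaguerre_rc r c n a p q : {poly K} :=
  lqLaguerre n (a * bpow p r * bpow q c) (bshift r p) (bshift c q).

(* for [i < 0] the index [k] is the opposite of the one ranging over
   [i .. -1] *)
Definition moment a p q (i j : int) : K :=
  match i with
  | Posz i => \prod_(0 <= k < i) (1 - a * bpow p k%:Z * bpow q j)
  | Negz i => \prod_(1 <= k < i.+2) (1 - a * bpow p (- k%:Z) * bpow q j)^-1
  end.

Definition lqLaguerre_norm a p q r c n : K :=
  moment a p q r (c + n%:Z) * a ^+ n *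
  \prod_(0 <= k < n)
     (bpow p (r + k%:Z) * (bpow q (c + k%:Z) - bpow q (c + n%:Z))).
End LittleQLaguerre.

(* Main.v *)
Require Import Defs.
From HB Require Import structures.
From mathcomp Require Import all_boot all_order all_algebra.
From mathcomp Require Import finmap complex.
From mathcomp Require Import reals.
From mathcomp Require Import monalg.
From mathcomp Require Import ring.

Set Implicit Arguments.
Unset Strict Implicit.
Unset Printing Implicit Defensive.

Import Order.TTheory GRing.Theory Num.Theory.
Local Open Scope ring_scope.

(** The moments with nonnegative first index are products of factors linear in
    the second power: after the shift by [(r, c)], with [P_k] and [Q_k] the
    powers of the shifted sequences and [a' = a P_r Q_c],
      [F (x^(r+i) y^(c+j)) = f_(r,c+j) \prod_(k < i) (1 - a' P_k Q_j)].
    Hence [F (x^r y^(c+j) g)] is [f_(r,c+j)] times the value at [z = Q_j] of the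
    polynomial in [z] obtained from [g] by substituting
    [\prod_(k < i) (1 - a' P_k z)] for [x^i]. For the little q-Laguerre
    polynomial of degree [n] this polynomial factors completely
    ([lqLaguerre_coef_sum]): it is [\prod_(k < n) P_k (a' Q_k - a' z)]. It
    vanishes at [Q_0, ..., Q_(n-1)], and its value at [Q_n] is the norm.

    The factorization is a Newton expansion ([newton_expansion]): with
    [w = a' z], the product [\prod_(k < n) (b_k - w)] over the nodes
    [b_k = a' Q_k] is expanded in the products [\prod_(k < i) (t_k - w)] over the
    nodes [t_k = P_k^-1]. Writing [b_0 - w = (b_0 - t_i) + (t_i - w)] gives a
    recurrence for the coefficients in which the [b_k] are shifted by one, and
    the sum over [i >= nu_i >= ... >= nu_(n-1) >= 0] obeys the same recurrence,
    obtained by separating the sequences with [nu_i = i] from those with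
    [nu_i < i].

    The norm is nonzero, and the moments are well defined, because a Laurent
    monomial in independent indeterminates in which one of them has nonzero
    exponent is different from 1 ([exponent_neq1]). *)

(** * Sums over nonincreasing sequences *)

Section DecreasingSums.
Variable K : fieldType.
Implicit Types (F : nat -> nat -> K).

(** The sum of [\prod_(s < N) F s (nu_s)] over the sequences
    [m >= nu_0 >= ... >= nu_(N-1) >= 0]. Recursion on the first term makes
    the separation of its largest value [m] an instance of [big_ord_recr]; the
    same separation on the sum over finite functions would change the codomain. *)
Fixpoint decsum (N m : nat) F : K :=
  if N is N'.+1 then \sum_(v < m.+1) F 0 v * decsum N' v (fun s => F s.+1)
  else 1.

Lemma decsum0 m F : decsum 0 m F = 1.
Proof. by []. Qed.

Lemma decsumS N m F : decsum N.+1 m F =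
  \sum_(v < m.+1) F 0%N v * decsum N v (fun s => F s.+1).
Proof. by []. Qed.

Arguments decsum : simpl never.

Lemma eq_decsum N m F G :
  (forall s v, (v <= m)%N -> F s v = G s v) -> decsum N m F = decsum N m G.
Proof.
elim: N m F G => [//|N IHN] m F G FG; rewrite !decsumS; apply: eq_bigr => v _.
rewrite FG -1?ltnS //; congr (_ * _); apply: IHN => s w wv.
by apply: FG; apply: leq_trans wv _; rewrite -ltnS.
Qed.

Definition nonincreasing M N (nu : {ffun 'I_N -> 'I_M}) : bool :=
  [forall s : 'I_N, forall t : 'I_N, (s <= t)%N ==> (nu t <= nu s)%N].

Definition fcons M N (v : 'I_M) (mu : {ffun 'I_N -> 'I_M}) :
    {ffun 'I_N.+1 -> 'I_M} :=
  [ffun s => oapp mu v (unlift ord0 s)].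

Lemma fcons0 M N (v : 'I_M) (mu : {ffun 'I_N -> 'I_M}) : fcons v mu ord0 = v.
Proof. by rewrite ffunE unlift_none. Qed.

Lemma fconsS M N (v : 'I_M) (mu : {ffun 'I_N -> 'I_M}) s :
  fcons v mu (lift ord0 s) = mu s.
Proof. by rewrite ffunE liftK. Qed.

Lemma fcons_bij M N :
  bijective (fun vm : 'I_M * {ffun 'I_N -> 'I_M} => fcons vm.1 vm.2).
Proof.
exists (fun nu : {ffun 'I_N.+1 -> 'I_M} =>
  (nu ord0, [ffun s => nu (lift ord0 s)])).
  move=> [v mu]; rewrite fcons0; congr (_, _).
  by apply/ffunP => s; rewrite ffunE fconsS.
move=> nu; apply/ffunP => s.
by case: (unliftP ord0 s) => [t|] ->; rewrite ?fconsS ?fcons0 ?ffunE.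
Qed.

(** The bound [m] on all the terms only concerns the first one, which in turn
    bounds the others: this is the recursive clause of [decsum]. *)
Lemma nonincreasing_fcons M N m (v : 'I_M) (mu : {ffun 'I_N -> 'I_M}) :
  nonincreasing (fcons v mu) && [forall s, (fcons v mu s <= m)%N] =
  (v <= m)%N && (nonincreasing mu && [forall s, (mu s <= v)%N]).
Proof.
apply/andP/andP => [[/forallP dec /forallP le_m]|
  [vm /andP[/forallP dec /forallP le_v]]].
  have decE (s t : 'I_N.+1) : (s <= t)%N -> (fcons v mu t <= fcons v mu s)%N.
    by move=> st; have /forallP/(_ t)/implyP := dec s; apply.
  split; first by have := le_m ord0; rewrite fcons0.
  apply/andP; split; last first.
    apply/forallP => s; have := decE ord0 (lift ord0 s) isT.
    by rewrite fcons0 fconsS.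
  apply/forallP => s; apply/forallP => t; apply/implyP => st.
  by have := decE (lift ord0 s) (lift ord0 t); rewrite !fconsS; apply.
split; last first.
  apply/forallP => s.
  case: (unliftP ord0 s) => [t|] ->; rewrite ?fconsS ?fcons0 //.
  exact: leq_trans (le_v t) vm.
apply/forallP => s; apply/forallP => t; apply/implyP.
case: (unliftP ord0 s) => [s'|] ->; case: (unliftP ord0 t) => [t'|] ->;
  rewrite ?fconsS ?fcons0 // => st.
by have /forallP/(_ t')/implyP := dec s'; apply.
Qed.

(** The codomain ['I_M] is kept independent of the bound [m] because the bound
    varies in the induction. *)
Lemma sum_nonincreasing M N m F : (m < M)%N ->
  \sum_(nu : {ffun 'I_N -> 'I_M} | nonincreasing nu && [forall s, (nu s <= m)%N])
     \prod_(s < N) F s (nu s) = decsum N m F.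
Proof.
move=> mM; elim: N m mM F => [|N IHN] m mM F.
  rewrite (big_pred1 [ffun=> Ordinal mM]) ?big_ord0 ?decsum0 // => nu /=.
  have -> : nu == [ffun=> Ordinal mM] by apply/eqP/ffunP => -[].
  by apply/andP; split; apply/forallP => -[].
rewrite decsumS (reindex _ (onW_bij _ (@fcons_bij M N))) /=.
rewrite (eq_bigl _ _ (fun vm => nonincreasing_fcons m vm.1 vm.2)).
rewrite (eq_bigr (fun vm : 'I_M * {ffun 'I_N -> 'I_M} =>
  F 0%N vm.1 * \prod_(s < N) F s.+1 (vm.2 s))); last first.
  move=> [v mu] _; rewrite big_ord_recl fcons0; congr (_ * _).
  by apply: eq_bigr => s _; rewrite fconsS.
rewrite -(pair_big_dep (fun v : 'I_M => v <= m)%N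
  (fun v mu => nonincreasing mu && [forall s, (mu s <= v)%N])
  (fun v mu => F 0%N v * \prod_(s < N) F s.+1 (mu s))) /=.
rewrite (big_ord_widen _ (fun v => F 0%N v * decsum N v (fun s => F s.+1)) mM).
by apply: eq_bigr => v _; rewrite -mulr_sumr -(IHN _ (ltn_ord v)).
Qed.

(** The coefficient on the right is the divided difference of the left-hand
    side, up to sign, at the nodes [t 0, ..., t i]. The proof is by induction
    on [n], removing the factor [b 0 - w] and shifting [b]. *)
Lemma newton_expansion n (b : int -> K) (t : nat -> K) w :
  \prod_(k < n) (b k%:Z - w) =
  \sum_(i < n.+1)
     decsum (n - i) i (fun s v => b ((i + s)%N%:Z - v%:Z) - t v) *
     \prod_(k < i) (t k - w).
Proof.
pose W i (b' : int -> K) s v := b' ((i + s)%N%:Z - v%:Z) - t v.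
rewrite (eq_bigr (fun i : 'I_n.+1 => decsum (n - i) i (W i b) *
   \prod_(k < i) (t k - w))) //.
elim: n b => [|n IHn] b.
  by rewrite big_ord0 big_ord1 big_ord0 decsum0 mulr1.
pose Sb j := b (1 + j).
have WS i s v : W i b s.+1 v = W i Sb s v.
  by rewrite /W /Sb addrA; congr (b (_ - _) - _); rewrite addnS.
have WSi i s v : W i.+1 b s v = W i Sb s v.
  by rewrite /W /Sb addrA; congr (b (_ - _) - _).
have W0 i : W i b 0%N i = b 0 - t i by rewrite /W addn0 subrr.
(* The largest first value [v = i] has weight [b 0 - t i]; if [v < i], then
   the height [i] can be lowered by one, which is again a shift of [b]. *)
have Wrec i N : decsum N.+1 i (W i b) = (b 0 - t i) * decsum N i (W i Sb)
    + (if i is i'.+1 then decsum N.+1 i' (W i' Sb) else 0).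
  rewrite decsumS big_ord_recr /= W0 addrC; congr (_ * _ + _).
    by apply: eq_decsum => s v _; exact: WS.
  case: i => [|i] in WS WSi W0 *; first by rewrite big_ord0.
  rewrite decsumS; apply: eq_bigr => v _; rewrite WSi; congr (_ * _).
  by apply: eq_decsum => s u _; rewrite WSi.
rewrite big_ord_recl (eq_bigr (fun k : 'I_n => Sb k%:Z - w)); last first.
  by move=> k _; rewrite /Sb /= /bump add1n -PoszD.
rewrite IHn mulr_sumr.
rewrite (eq_bigr (fun i : 'I_n.+1 =>
    (b 0 - t i) * decsum (n - i) i (W i Sb) * \prod_(k < i) (t k - w)
    + decsum (n - i) i (W i Sb) * \prod_(k < i.+1) (t k - w))); last first.
  by move=> i _; rewrite [\prod_(k < i.+1) _]big_ord_recr /=; ring.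
rewrite big_split /= [RHS]big_ord_recr /= subnn decsum0.
rewrite [X in _ + X]big_ord_recr /= subnn decsum0 addrA; congr (_ + _).
(* [(n - i').-1.+1] is [n - i'], written so that [Wrec] applies. *)
rewrite [RHS](eq_bigr (fun i : 'I_n.+1 =>
    (b 0 - t i) * decsum (n - i) i (W i Sb) * \prod_(k < i) (t k - w)
    + (if (i : nat) is i'.+1 then decsum (n - i').-1.+1 i' (W i' Sb) else 0)
      * \prod_(k < i) (t k - w))); last first.
  move=> i _; have lein : (i <= n)%N by rewrite -ltnS.
  rewrite subSn // Wrec mulrDl; congr (_ + _ * _).
  by case: (nat_of_ord i) lein => [//|i'] lt; rewrite subnS.
rewrite [RHS]big_split /=; congr (_ + _).
rewrite [RHS]big_ord_recl /= mul0r add0r; apply: eq_bigr => i _.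
by rewrite add0n prednK // subn_gt0.
Qed.
End DecreasingSums.

(** * Orthogonality over a field with nonvanishing parameters *)

Section Orthogonality.
Variable K : fieldType.
Implicit Types (a z : K) (p q x : int -> K).

Lemma bpow_neq0 x m : (forall k, x k != 0) -> bpow x m != 0.
Proof.
by move=> x0; case: m => m /=; rewrite prodf_seq_neq0; apply/allP => k _ /=;
  rewrite ?invr_eq0 //.
Qed.

Lemma bpow0 x : bpow x 0 = 1.
Proof. by rewrite /= big_geq. Qed.

Lemma bpowS x m : (forall k, x k != 0) -> bpow x (m + 1) = bpow x m * x (m + 1).
Proof.
move=> x0; case: m => m.
  by rewrite -PoszD addn1 /bpow big_nat_recr.
have -> : Negz m + 1 = - m%:Z by rewrite NegzE -addn1 PoszD opprD addrNK.
rewrite [bpow x (Negz m)]/= big_nat_recr //= mulfVK //.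
by case: m => [|m] //; rewrite bpow0 big_geq.
Qed.

Local Arguments bpow : simpl never.

Lemma bpow_shift x s k : (forall k, x k != 0) ->
  bpow x (s + k%:Z) = bpow x s * bpow (bshift s x) k%:Z.
Proof.
move=> x0; elim: k => [|k IHk]; first by rewrite addr0 bpow0 mulr1.
rewrite -addn1 PoszD addrA !bpowS ?IHk -?mulrA // => [|i]; last exact: x0.
by rewrite /bshift addrA.
Qed.

(** The recurrence holds across [i = 0], where the definition changes form. *)
Lemma momentS a p q i j : (forall k, 1 - a * bpow p k * bpow q j != 0) ->
  moment a p q (i + 1) j = moment a p q i j * (1 - a * bpow p i * bpow q j).
Proof.
move=> nz; case: i => i.
  by rewrite -PoszD addn1 /moment big_nat_recr.
have -> : Negz i + 1 = - i%:Z by rewrite NegzE -addn1 PoszD opprD addrNK.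
rewrite [moment a p q (Negz i) j]/= big_nat_recr // -NegzE mulfVK ?nz //.
by case: i => [|i] //=; rewrite !big_geq.
Qed.

Lemma moment_neq0 a p q i j : (forall k, 1 - a * bpow p k * bpow q j != 0) ->
  moment a p q i j != 0.
Proof.
by move=> nz; case: i => i; rewrite /moment prodf_seq_neq0; apply/allP => k _;
  rewrite implyTb ?invr_eq0 nz.
Qed.

Lemma momentD a p q r i j : (forall k, 1 - a * bpow p k * bpow q j != 0) ->
  moment a p q (r + i%:Z) j =
  moment a p q r j * \prod_(k < i) (1 - a * bpow p (r + k%:Z) * bpow q j).
Proof.
move=> nz; elim: i => [|i IHi]; first by rewrite addr0 big_ord0 mulr1.
by rewrite -addn1 PoszD addrA momentS // IHi addn1 big_ord_recr /= mulrA.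
Qed.

Definition lqLaguerre_coef n a p q (i : nat) : K :=
  (\prod_(i <= k < n) bpow p k%:Z) *
  decsum (n - i) i
    (fun s v => a * bpow q ((i + s)%N%:Z - v%:Z) - (bpow p v%:Z)^-1).

Lemma lqLaguerreE n a p q :
  lqLaguerre n a p q = \sum_(i < n.+1) lqLaguerre_coef n a p q i *: 'X^i.
Proof.
rewrite /lqLaguerre big_mkord; apply: eq_bigr => i _; congr ((_ * _) *: _).
rewrite -(sum_nonincreasing _ _ (ltnSn i)); apply: eq_bigl => nu.
suff -> : [forall s, (nu s <= i)%N] by rewrite andbT.
by apply/forallP => s; rewrite -ltnS.
Qed.

(** Multiplying the Newton expansion of [\prod_(k < n) (a * bpow q k - a * z)] in
    the nodes [(bpow p k)^-1] by [\prod_(k < n) bpow p k] clears the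
    denominators: the first [i] factors turn [(bpow p k)^-1 - a * z] into
    [1 - a * bpow p k * z], and the others are the prefactor of the [i]-th
    coefficient. *)
Lemma lqLaguerre_coef_sum n a p q z : (forall k, p k != 0) ->
  \sum_(i < n.+1) lqLaguerre_coef n a p q i *
      \prod_(k < i) (1 - a * bpow p k%:Z * z) =
  \prod_(k < n) (bpow p k%:Z * (a * bpow q k%:Z - a * z)).
Proof.
move=> p0; have P0 m : bpow p m != 0 by exact: bpow_neq0.
rewrite big_split /= (newton_expansion n (fun k => a * bpow q k)
  (fun k => (bpow p k%:Z)^-1) (a * z)) mulr_sumr.
apply: eq_bigr => i _; have lein : (i <= n)%N by rewrite -ltnS.
have -> : \prod_(k < i) (1 - a * bpow p k%:Z * z) =
    \prod_(0 <= k < i) bpow p k%:Z * \prod_(k < i) ((bpow p k%:Z)^-1 - a * z).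
  rewrite big_mkord -big_split; apply: eq_bigr => k _ /=.
  by rewrite mulrBr mulfV //; ring.
rewrite -(big_mkord xpredT (fun k => bpow p k%:Z)).
by rewrite (big_cat_nat _ lein) //= /lqLaguerre_coef; ring.
Qed.

Lemma lmonX i : lmon K 1 0 ^+ i = lmon K i%:Z 0.
Proof.
elim: i => [|i IHi]; first by rewrite expr0.
by rewrite exprS IHi lmonM addr0 -PoszD.
Qed.

(** The orthogonality holds over any field in which the moments are defined. *)
Lemma lqLaguerre_orthogonality a p q (F : {scalar laurent K})
    (hF : forall i j, F (lmon K i j) = moment a p q i j)
    (p0 : forall k, p k != 0) (q0 : forall k, q k != 0)
    (apq1 : forall k j, 1 - a * bpow p k * bpow q j != 0) r c n j :
  (j <= n)%N ->
  F (lmon K r (c + j%:Z) * horner_alg (lmon K 1 0) (lqLaguerre_rc r c n a p q))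
  = lqLaguerre_norm a p q r c n * (j == n)%:R.
Proof.
move=> le_jn; set a' := a * bpow p r * bpow q c.
set p' := bshift r p; set q' := bshift c q.
have p'0 k : p' k != 0 by exact: p0.
have -> : F (lmon K r (c + j%:Z) *
    horner_alg (lmon K 1 0) (lqLaguerre_rc r c n a p q)) =
  moment a p q r (c + j%:Z) *
    \prod_(k < n) (bpow p' k%:Z * (a' * bpow q' k%:Z - a' * bpow q' j%:Z)).
  rewrite -lqLaguerre_coef_sum // /lqLaguerre_rc lqLaguerreE.
  rewrite [RHS]mulr_sumr [X in _ * X]linear_sum [X in F X]mulr_sumr.
  rewrite [LHS]linear_sum.
  apply: eq_bigr => i _.
  (* [linearZ] produces the scalar as [_%:A] in the algebra. *)
  rewrite [X in F (_ * X)]linearZ /= mulr_algl -scalerAr [LHS]linearZ /=.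
  rewrite rmorphXn /= horner_algX lmonX lmonM.
  rewrite addr0 hF momentD // mulrCA; congr (_ * (_ * _)).
  by apply: eq_bigr => k _; rewrite !bpow_shift // /a'; ring.
(* For [j < n] the factor of index [k = j] vanishes. *)
have [->|ne_jn] := eqVneq j n; last first.
  have lt_jn : (j < n)%N by rewrite ltn_neqAle ne_jn.
  by rewrite mulr0 (bigD1 (Ordinal lt_jn)) //= subrr mulr0 mul0r mulr0.
rewrite mulr1 /lqLaguerre_norm -mulrA; congr (_ * _).
rewrite big_mkord -[X in a ^+ X]card_ord -prodr_const -big_split /=.
by apply: eq_bigr => k _; rewrite !bpow_shift // /a'; ring.
Qed.
End Orthogonality.

(** * Laurent monomials in the field of rational functions *)

Lemma cross_mul (K : fieldType) (x y z t : K) :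
  y != 0 -> t != 0 -> x / y = z / t -> x * t = z * y.
Proof. by move=> y0 t0 /eqP; rewrite eqr_div // => /eqP. Qed.

Section MonomialExponents.
Variable C : idomainType.
Implicit Types (v : indet) (m : {cmonom indet}) (x y : ratfun C).

Definition tomonom m : ratfun C :=
  FracField.tofrac (<< m >> : {malg C[{cmonom indet}]}).

Lemma tomonomM m1 m2 : tomonom (mmul m1 m2) = tomonom m1 * tomonom m2.
Proof.
by rewrite /tomonom -tofracM malgM_def fgmulUU mulr1.
Qed.

Lemma tomonom_inj : injective tomonom.
Proof.
move=> m1 m2 /eqP; rewrite tofrac_eq => /eqP eqU.
have U1 (k : {cmonom indet}) :
    mcoeff m1 (<< k >> : {malg C[{cmonom indet}]}) = (k == m1)%:R.
  exact: mcoeffU1.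
have := U1 m1.
rewrite eqU.
rewrite U1 eqxx.
case: (m2 =P m1) => [->//|_] /eqP.
by rewrite eq_sym oner_eq0.
Qed.

Lemma tomonom_neq0 m : tomonom m != 0.
Proof. by rewrite tofrac_eq0 monalgU_eq0 oner_eq0. Qed.

(** Monomials have no inverses in the polynomial ring, so a Laurent monomial is
    presented as a quotient; the exponent [e] of [v] in it does not depend on
    the presentation, by [exponent_uniq]. *)
Definition exponent v (e : int) x : Prop :=
  exists2 m12 : {cmonom indet} * {cmonom indet},
    x = tomonom m12.1 / tomonom m12.2 & (m12.1 v)%:Z - (m12.2 v)%:Z = e.

Lemma exponent_gen v w : exponent v (w == v)%:Z (gen C w).
Proof.
exists (ucm w, mone); last by rewrite /= cm1 cmU subr0.
suff -> : tomonom mone = 1 by rewrite divr1.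
by rewrite /tomonom -[RHS]tofrac1.
Qed.

Lemma exponent1 v : exponent v 0 1.
Proof. by exists (mone, mone); rewrite ?subrr // divff ?tomonom_neq0. Qed.

Lemma exponentM v e1 e2 x y :
  exponent v e1 x -> exponent v e2 y -> exponent v (e1 + e2) (x * y).
Proof.
move=> [[m1 m2] -> <-] [[k1 k2] -> <-].
exists (mmul m1 k1, mmul m2 k2) => /=; first by rewrite !tomonomM mulf_div.
by rewrite !cmM !PoszD; ring.
Qed.

Lemma exponentV v e x : exponent v e x -> exponent v (- e) x^-1.
Proof.
by move=> [[m1 m2] -> <-]; exists (m2, m1); rewrite /= ?invf_div // opprB.
Qed.

Lemma exponent_uniq v e1 e2 x : exponent v e1 x -> exponent v e2 x -> e1 = e2.
Proof.
move=> [[m1 m2] /= -> <-] [[k1 k2] /= eqx <-].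
have /tomonom_inj eqm : tomonom (mmul m1 k2) = tomonom (mmul k1 m2).
  rewrite !tomonomM; apply: cross_mul (eqx); exact: tomonom_neq0.
have := congr1 (fun m : {cmonom indet} => (m v)%:Z) eqm.
rewrite /= !cmM !PoszD => eqz.
apply/eqP; rewrite subr_eq addrAC eq_sym subr_eq eqz.
by apply/eqP.
Qed.

(** This is the independence of the indeterminates, in the form that separates
    the products below from 1. *)
Lemma exponent_neq1 v e x : exponent v e x -> e != 0 -> x != 1.
Proof.
move=> xe; apply: contra_neq => x1; rewrite x1 in xe.
exact: exponent_uniq xe (exponent1 v).
Qed.

Lemma exponent_prod0 v (I : Type) (s : seq I) (P : pred I) (E : I -> ratfun C) :
  (forall i, P i -> exponent v 0 (E i)) ->
  exponent v 0 (\prod_(i <- s | P i) E i).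
Proof.
move=> E0; apply: (big_ind (exponent v 0)) => //; first exact: exponent1.
by move=> x y x0 y0; rewrite -[0]addr0; apply: exponentM.
Qed.

Lemma exponent_bpow0 v (g : int -> ratfun C) (k : int) :
  (forall i, exponent v 0 (g i)) -> exponent v 0 (bpow g k).
Proof.
move=> g0; case: k => k; apply: exponent_prod0 => i _ //.
by rewrite -oppr0; apply: exponentV.
Qed.

Lemma gen_neq0 v : gen C v != 0.
Proof. by rewrite tofrac_eq0 monalgU_eq0 oner_eq0. Qed.

(** The variable [a] has exponent 1 in [a * bpow p k * bpow q j]. *)
Lemma one_sub_apq_neq0 k j :
  1 - gen_a C * bpow (gen_p C) k * bpow (gen_q C) j != 0.
Proof.
rewrite subr_eq0 eq_sym; apply: (@exponent_neq1 IndA 1) => //.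
rewrite -[1]addr0 -[1]addr0; apply: exponentM; first apply: exponentM.
- exact: (exponent_gen IndA IndA).
- by apply: exponent_bpow0 => i; exact: (exponent_gen IndA (IndP i)).
- by apply: exponent_bpow0 => i; exact: (exponent_gen IndA (IndQ i)).
Qed.

(** The quotient of the two powers is [q_(c+k+1) ... q_(c+n)], in which
    [q_(c+n)] has exponent 1. *)
Lemma bpow_gen_q_sub_neq0 c k n : (k < n)%N ->
  bpow (gen_q C) (c + k%:Z) - bpow (gen_q C) (c + n%:Z) != 0.
Proof.
move=> ltkn; have q0 i : gen_q C i != 0 by exact: gen_neq0.
have -> : c + n%:Z = c + k%:Z + (n - k.+1).+1%:Z.
  by rewrite -addrA -PoszD -subSn // subSS subnKC // ltnW.
set d := (n - k.+1)%N; set s := c + k%:Z.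
rewrite bpow_shift // -[X in X - _]mulr1 -mulrBr mulf_neq0 ?bpow_neq0 //.
rewrite subr_eq0 eq_sym; apply: (@exponent_neq1 (IndQ (s + d.+1%:Z)) 1) => //.
rewrite /bpow big_nat_recr //= -[1]add0r; apply: exponentM.
  rewrite big_nat; apply: exponent_prod0 => i /andP[_ ltid].
  have := exponent_gen (IndQ (s + d.+1%:Z)) (IndQ (s + i%:Z)).
  by case: eqP => [[/addrI [eqid]]|//]; rewrite eqid ltnn in ltid.
by have := exponent_gen (IndQ (s + d.+1%:Z)) (IndQ (s + d.+1%:Z)); rewrite eqxx.
Qed.

Lemma lqLaguerre_norm_gen_neq0 r c n :
  lqLaguerre_norm (gen_a C) (gen_p C) (gen_q C) r c n != 0.
Proof.
rewrite /lqLaguerre_norm !mulf_neq0 ?expf_neq0 ?gen_neq0 //.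
  by apply: moment_neq0 => k; exact: one_sub_apq_neq0.
rewrite big_mkord; apply/prodf_neq0 => k _; rewrite mulf_neq0 //.
  by apply: bpow_neq0 => i; exact: gen_neq0.
exact: bpow_gen_q_sub_neq0.
Qed.

End MonomialExponents.

Theorem theorem12 (R : realType)
    (F : {scalar laurent (ratfun R[i])})
    (hF : forall i j : int,
        F (lmon _ i j) = moment (gen_a R[i]) (gen_p R[i]) (gen_q R[i]) i j)
    (r c : int) (n : nat) :
  (forall j : nat, (j <= n)%N ->
     F (lmon _ r (c + j%:Z) *
        horner_alg (lmon _ 1 0)
          (lqLaguerre_rc r c n (gen_a R[i]) (gen_p R[i]) (gen_q R[i])))
     = lqLaguerre_norm (gen_a R[i]) (gen_p R[i]) (gen_q R[i]) r c n
       * (j == n)%:R)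
  /\ lqLaguerre_norm (gen_a R[i]) (gen_p R[i]) (gen_q R[i]) r c n != 0.
Proof.
split=> [j le_jn|]; last exact: lqLaguerre_norm_gen_neq0.
apply: lqLaguerre_orthogonality le_jn => // [k|k|k l].
- exact: gen_neq0.
- exact: gen_neq0.
- exact: one_sub_apq_neq0.
Qed.
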